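(* Let $a>0$ and $c\in(-1,1)$ with $c\ge0$, and let $p_c(z)=a(1-cz^2)$ for $z\in D$. Then the inequality $$2\,\mathrm{Re}(p_c(z))\,\frac{1+|z|^2}{1-|z|^2}+2\,\mathrm{Re}(z\,p_c'(z))\ \ge\ 2a$$ holds for all $z\in D$ if and only if $c\le 2/3$.
   Context: $D=\{z\in\mathbb{C}:|z|<1\}$ is the open unit disc. *)

(* Defs.v *)
From Stdlib Require Import Reals Lra.
From Coquelicot Require Import Coquelicot.

Open Scope R_scope.

Definition unit_disc (z : C) : Prop := Cmod z < 1.

Definition p (a c : R) (z : C) : C := (RtoC a * (1 - RtoC c * z ^ 2))%C.

(* [C_derive] is a total function, computed from a limit along the real
   direction, and is the complex derivative only where the latter exists.
   This lemma and [C_derive_correct] show that [C_derive (p a c) z] is the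
   complex derivative of [p a c] at every [z]. *)
Lemma ex_derive_p (a c : R) (z : C) : ex_derive (p a c) z.
Proof.
exists (RtoC a * (- (RtoC c * (2*z))))%C.
split. apply is_linear_scal_l.
intros x Hx.
pose proof (@is_filter_lim_locally_unique C_AbsRing (AbsRing_NormedModule C_AbsRing) _ _ Hx) as <-.
intros eps.
assert (Hk : 0 < Rabs (a*c) + 1) by (pose proof (Rabs_pos (a*c)); lra).
exists (mkposreal _ (Rdiv_lt_0_compat _ _ (cond_pos eps) Hk)).
intros y Hy.
change (Cmod (y - z) < eps / (Rabs (a*c) + 1)) in Hy.
change (Cmod ((p a c y - p a c z) - (y - z) * (RtoC a * (- (RtoC c * (2*z))))) <= eps * Cmod (y - z)).
unfold p.
replace (_ - _ - _)%C with (RtoC (- (a*c)) * (y-z) * (y-z))%C by (rewrite RtoC_opp, RtoC_mult; simpl; ring).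
rewrite !Cmod_mult, Cmod_R, Rabs_Ropp.
apply Rmult_le_compat_r; [apply Cmod_ge_0|].
apply Rlt_div_r in Hy; [|exact Hk].
pose proof (Cmod_ge_0 (y-z)). nra.
Qed.

(* Main.v *)
Require Import Defs.
From Stdlib Require Import Reals Lra.
From Coquelicot Require Import Coquelicot.

Open Scope R_scope.

(** Write [x + iy] for [z], [t] for [|z|^2] and [X] for [Re (z^2) = x^2 - y^2].
    Since [p' z = -2acz], every term on the left-hand side depends only on [t]
    and [X]: it is [2a ((1 - cX) (1 + t) / (1 - t) - 2cX)].  Subtracting [2a]
    and clearing the positive denominator [1 - t], everything that is free of [c]
    collapses to [2t], and the inequality becomes [cX (3 - t) <= 2t]
    ([disc_inequality_iff]).

    For fixed [t] the worst case is [X = t], that is, [z] real, where the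
    condition reads [c (3 - t) <= 2]; its left-hand side increases to [3c] as
    [t] tends to [0].  So [c <= 2/3] suffices, and it is necessary because [z]
    may be real, nonzero and arbitrarily small. *)

(** [C] is a normed module over itself in two ways: as an absolute-value ring,
    which is where the product rule holds, and through its product structure,
    which is where [C_derive] is characterised.  The uniform structures differ
    but the norm is [Cmod] in both, and a derivative sees only the norm of its
    codomain. *)
Lemma is_derive_C_NormedModule (f : C -> C) (z l : C) :
  @is_derive C_AbsRing (AbsRing_NormedModule C_AbsRing) f z l ->
  @is_derive C_AbsRing C_NormedModule f z l.
Proof.
intros [_ H]. split; [apply is_linear_scal_l | exact H].
Qed.

Lemma C_derive_p (a c : R) (z : C) :
  C_derive (p a c) z = (- (RtoC a * RtoC c * (z + z)))%C.
Proof.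
apply is_C_derive_unique, is_derive_C_NormedModule.
pose proof (@is_derive_id C_AbsRing z) as Hid.
pose proof (@is_derive_mult C_AbsRing _ _ z _ _ Hid Hid Cmult_comm) as Hsqr.
pose proof (@is_derive_scal_l C_AbsRing (AbsRing_NormedModule C_AbsRing)
              _ z _ (RtoC a * RtoC c)%C Hsqr) as Hscal.
pose proof (is_derive_minus _ _ z _ _
              (@is_derive_const C_AbsRing (AbsRing_NormedModule C_AbsRing)
                 (RtoC a) z)
              Hscal) as H.
match type of H with is_derive _ _ ?l =>
  replace (- (RtoC a * RtoC c * (z + z)))%C with (l : C)
    by (apply injective_projections; simpl; ring)
end.
refine (is_derive_ext _ _ _ _ _ H).
intro w. unfold p. apply injective_projections; simpl; ring.
Qed.

Lemma Cmod_sqr (x y : R) : Cmod (x, y) ^ 2 = x ^ 2 + y ^ 2.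
Proof.
unfold Cmod; simpl fst; simpl snd.
rewrite pow2_sqrt; [reflexivity | nra].
Qed.

(** Both real parts are polynomial in the coordinates of [z], so the two sides
    differ by [2a / (1 - t)] times [2t - cX (3 - t)]. *)
Lemma disc_inequality_iff (a c x y : R) :
  0 < a -> x ^ 2 + y ^ 2 < 1 ->
  (2 * Re (p a c (x, y)) * ((1 + Cmod (x, y) ^ 2) / (1 - Cmod (x, y) ^ 2))
     + 2 * Re ((x, y) * C_derive (p a c) (x, y))%C >= 2 * a
   <-> c * (x ^ 2 - y ^ 2) * (3 - (x ^ 2 + y ^ 2)) <= 2 * (x ^ 2 + y ^ 2)).
Proof.
intros Ha Ht.
rewrite C_derive_p, Cmod_sqr.
set (t := x ^ 2 + y ^ 2) in *.
set (X := x ^ 2 - y ^ 2).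
replace (Re (p a c (x, y))) with (a * (1 - c * X))
  by (unfold X, p, Re; simpl; ring).
replace (Re ((x, y) * - (RtoC a * RtoC c * ((x, y) + (x, y))))%C)
  with (- 2 * a * c * X) by (unfold X, Re; simpl; ring).
set (k := 2 * a / (1 - t)).
assert (Hk : 0 < k) by (apply Rdiv_lt_0_compat; lra).
assert (E : 2 * (a * (1 - c * X)) * ((1 + t) / (1 - t))
              + 2 * (- 2 * a * c * X) - 2 * a
            = k * (2 * t - c * X * (3 - t)))
  by (unfold k; field; lra).
split; intro H.
- apply Rnot_lt_le; intro Hlt.
  assert (0 < k * (c * X * (3 - t) - 2 * t)) by (apply Rmult_lt_0_compat; lra).
  lra.
- assert (0 <= k * (2 * t - c * X * (3 - t))) by (apply Rmult_le_pos; lra).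
  lra.
Qed.

Lemma unit_disc_sqr (x y : R) : unit_disc (x, y) <-> x ^ 2 + y ^ 2 < 1.
Proof.
unfold unit_disc. rewrite <- Cmod_sqr.
pose proof (Cmod_ge_0 (x, y)). split; intro; nra.
Qed.

Theorem theorem6 :
  forall a c : R, 0 < a -> -1 < c < 1 -> 0 <= c ->
    ((forall z : C, unit_disc z ->
        2 * Re (p a c z) * ((1 + Cmod z ^ 2) / (1 - Cmod z ^ 2))
          + 2 * Re (z * C_derive (p a c) z)%C >= 2 * a)
     <-> c <= 2 / 3).
Proof.
intros a c Ha Hc Hc0. split.
- intro H. apply Rnot_lt_le; intro Hlt.
  (* A real x violates the inequality when c (3 - x^2) > 2, that is,
     c x^2 < 3c - 2; as c x^2 < x for x in (0,1), half of 3c - 2 will do. *)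
  set (x := (3 * c - 2) / 2).
  assert (Hx : 0 < x < 1) by (unfold x; lra).
  assert (Hdisc : x ^ 2 + 0 ^ 2 < 1) by nra.
  specialize (H (x, 0) (proj2 (unit_disc_sqr x 0) Hdisc)).
  apply (disc_inequality_iff a c x 0 Ha Hdisc) in H.
  assert (Hx2 : 0 < x ^ 2) by nra.
  assert (Hsmall : c * x ^ 2 < 3 * c - 2).
  { replace (3 * c - 2) with (2 * x) by (unfold x; lra). nra. }
  assert (0 < x ^ 2 * (3 * c - 2 - c * x ^ 2)) by (apply Rmult_lt_0_compat; lra).
  lra.
- intros Hle [x y] Hz.
  apply unit_disc_sqr in Hz.
  apply disc_inequality_iff; [exact Ha | exact Hz |].
  set (t := x ^ 2 + y ^ 2) in *.
  assert (Ht : 0 <= t) by (unfold t; nra).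
  assert (HX : x ^ 2 - y ^ 2 <= t) by (unfold t; nra).
  apply Rle_trans with (c * t * (3 - t)).
  + apply Rmult_le_compat_r; [lra |].
    apply Rmult_le_compat_l; [exact Hc0 | exact HX].
  + assert (c * (3 - t) <= 2) by nra. nra.
Qed.
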